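(* Let $p$ be a prime, let $H$ be a proper multiplicative subgroup of $\mathbb{F}_p^*$, and suppose $H=A+B$ with $A,B\subseteq\mathbb{F}_p$, $|A|,|B|\geq2$, normalized so that $\sum_{a\in A}a=\sum_{b\in B}b=0$. Put $d=|H|$, $\alpha=|A|$, $\beta=|B|$, and $$F(X)=\prod_{b\in B}(X-b),\qquad G(X)=\prod_{a\in A}(X+a)\qquad\text{in }\mathbb{F}_p[X].$$ Then for every zero $b$ of $F$ and every zero $z$ of $G$, $$2(d-1)\frac{G'(b)}{G(b)}=\alpha(\alpha+1)\frac{F''(b)}{F'(b)},\qquad 2(d-1)\frac{F'(z)}{F(z)}=\beta(\beta+1)\frac{G''(z)}{G'(z)}$$ in $\mathbb{F}_p$. Moreover, $$\alpha(\alpha+1)\,G F''+\beta(\beta+1)\,F G''=2(d-1)\,F'G'$$ as polynomials in $\mathbb{F}_p[X]$.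
   Context: $\mathbb{F}_p$ is the finite field with $p$ elements, $\mathbb{F}_p^*=\mathbb{F}_p\setminus\{0\}$, and proper means $H\neq\mathbb{F}_p^*$. The sumset is $A+B=\{a+b:a\in A,\ b\in B\}$. Primes denote formal derivatives. Integers appearing as coefficients are interpreted in $\mathbb{F}_p$. The denominators $F'(b),G(b),G'(z),F(z)$ are nonzero, since $F$ and $G$ have simple roots and no common root. *)

(* Defs.v *)
From HB Require Import structures.
From mathcomp Require Import all_boot all_order all_algebra all_fingroup.

Set Implicit Arguments.
Unset Strict Implicit.
Unset Printing Implicit Defensive.

Import GRing.Theory.
Local Open Scope ring_scope.

Definition sumset (V : finZmodType) (A B : {set V}) : {set V} :=
  [set a + b | a in A, b in B].

(* Subgroups of the multiplicative group of a finite ring R are groups over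
   {unit R}; this is the underlying subset of R. *)
Definition unit_image (R : finUnitRingType) (H : {set {unit R}}) : {set R} :=
  [set val u | u in H].

(* Main.v *)
Require Import Defs.
From mathcomp Require Import all_boot all_order all_algebra all_fingroup.
From mathcomp Require Import cyclic finfield ring zify.

Set Implicit Arguments.
Unset Strict Implicit.
Unset Printing Implicit Defensive.

Import GRing.Theory.
Local Open Scope ring_scope.

(** The proof is Stepanov's method in the form of Hanson and Petridis, followed
by one more step of Taylor expansion.

Replace [A] by [C = -A], so that [G] is the monic polynomial with root set [C]
and every difference [b - c] lies in [H]; hence [(b - c) ^+ d = 1].  Let [w_c]
be the Lagrange weights of [C], that is [w_c = 1 / G'(c)].  The sum of
[w_c * h(c)] over [C] is the coefficient of degree [alpha - 1] of [h], for any
polynomial [h] of degree less than [alpha].  Consider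
  [P = \sum_c w_c (X - c)^(d + alpha - 1) - k].
Its coefficients of degree greater than [d] involve the sums of [w_c * c^i]
with [i < alpha - 1], so they vanish and [deg P <= d].  At a point [b] of [B]
the factor [(b - c)^d = 1] can be dropped, so for [0 < j < alpha] the [j]-th
Taylor coefficient of [P] at [b] is a multiple of the sum of
[w_c * (b - c)^(alpha - 1 - j)], which is zero; the constant [k] is chosen to
make the one for [j = 0] vanish as well.  Therefore [F^alpha] divides [P].
As [d = |H| <= alpha * beta] is the size bound for a sumset, [P] is a scalar
multiple of [F^alpha] ([stepanov_eq]).

Now compare the Taylor coefficients of degrees [alpha] and [alpha + 1] of the
two sides at [b].  On the side of [P] they are binomial multiples of the sums
of [w_c / (b - c)] and [w_c / (b - c)^2], which the partial fraction expansion
of [1 / G] evaluates to [1 / G(b)] and [G'(b) / G(b)^2].  On the side of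
[F^alpha] their ratio is [alpha * F''(b) / (2 * F'(b))].  Eliminating the
scalar gives the first formula ([stepanov_log_derivative]); the binomial
coefficient [C(d + alpha - 1, alpha)] can be cancelled because a proper
subgroup satisfies [2 * d <= p - 1], so that [d + alpha - 1 < p].  The second
formula is the same statement with [B] and [C] exchanged, where
[(c - b) ^+ d = (-1) ^+ d]; for this reason the argument is carried out for
differences whose [d]-th power is any nonzero constant [e].

The two families of relations say that the difference of the two sides of the
polynomial identity vanishes on the [alpha + beta] points of [B] and [C],
while its degree is less than [alpha + beta] ([poly_identity_of_roots]). *)

(** * Lagrange weights and partial fractions *)

Section Nodal.
Variable K : finFieldType.
Implicit Types (A B : {set K}) (f g : {poly K}).

Definition nodal A : {poly K} := \prod_(a in A) ('X - a%:P).

Lemma nodal_monic A : nodal A \is monic.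
Proof. exact: monic_prod_XsubC. Qed.

Lemma size_nodal A : size (nodal A) = #|A|.+1.
Proof. by rewrite /nodal -big_enum size_prod_XsubC -cardE. Qed.

Lemma root_nodal A x : root (nodal A) x = (x \in A).
Proof. by rewrite /nodal -big_enum root_prod_XsubC mem_enum. Qed.

Lemma nodalD1 A a : a \in A -> nodal A = ('X - a%:P) * nodal (A :\ a).
Proof. exact: big_setD1. Qed.

Lemma card_setD1 A a : a \in A -> #|A :\ a| = #|A|.-1.
Proof. by rewrite (cardsD1 a A) => ->. Qed.

Lemma nodal_neq0 A x : x \notin A -> (nodal A).[x] != 0.
Proof. by rewrite -root_nodal. Qed.

Lemma poly_eq_on A f g : {in A, forall x, f.[x] = g.[x]} ->
  (size f <= #|A|)%N -> (size g <= #|A|)%N -> f = g.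
Proof.
move=> fg sf sg; apply/eqP; rewrite -subr_eq0; apply/eqP.
apply: (@roots_geq_poly_eq0 _ _ (enum A)); rewrite ?enum_uniq //.
- by apply/allP=> x; rewrite mem_enum => /fg e; rewrite rootE !hornerE e subrr.
- by rewrite -cardE (leq_trans (size_polyD _ _)) // size_polyN geq_max sf.
Qed.

Definition weight A a : K := (nodal (A :\ a)).[a]^-1.

Lemma lagrange_interpolation A f : (size f <= #|A|)%N ->
  f = \sum_(a in A) (weight A a * f.[a]) *: nodal (A :\ a).
Proof.
move=> sf; apply: (@poly_eq_on A) => //; last first.
  apply: (leq_trans (size_sum _ _ _)); apply/bigmax_leqP => a aA.
  rewrite (leq_trans (size_scale_leq _ _)) // size_nodal card_setD1 //.
  by rewrite prednK // (cardD1 a) aA.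
move=> x xA; rewrite horner_sum (bigD1 x) //= big1 => [|a /andP[aA ax]].
  by rewrite addr0 hornerZ mulrAC mulVf ?mul1r // nodal_neq0 // !inE eqxx.
apply/eqP; rewrite hornerZ mulf_eq0 -rootE root_nodal.
by rewrite in_setD1 (eq_sym x) ax xA orbT.
Qed.

(** Compare the coefficients of degree [#|A| - 1] in Lagrange interpolation:
each basis polynomial is monic of exactly that degree. *)
Lemma sum_weight_horner A f : (size f <= #|A|)%N ->
  \sum_(a in A) weight A a * f.[a] = f`_#|A|.-1.
Proof.
move=> sf; rewrite [in RHS](lagrange_interpolation sf) coef_sum.
apply: eq_bigr => a aA; rewrite coefZ.
have /monicP := nodal_monic (A :\ a).
by rewrite lead_coefE size_nodal /= card_setD1 // => ->; rewrite mulr1.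
Qed.

Lemma sum_weight_exp A x k : (k < #|A|)%N ->
  \sum_(a in A) weight A a * (x - a) ^+ k = (-1) ^+ k *+ (k == #|A|.-1).
Proof.
move=> kA; set f := (-1) ^+ k *: ('X - x%:P) ^+ k.
have sf : size f = k.+1.
  by rewrite size_scale ?size_exp_XsubC // expf_neq0 // oppr_eq0 oner_eq0.
rewrite (eq_bigr (fun a => weight A a * f.[a])) => [|a _]; last first.
  by rewrite hornerZ horner_exp hornerXsubC -exprMn mulN1r opprB.
rewrite sum_weight_horner ?sf // coefZ.
have [->|neq] := eqVneq k #|A|.-1.
  have /monicP := rpredX #|A|.-1 (monicXsubC x).
  by rewrite lead_coefE size_exp_XsubC => ->; rewrite mulr1.
rewrite nth_default ?mulr0 ?mulr0n // size_exp_XsubC.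
by lia.
Qed.

(** Partial fractions: interpolate the constant polynomial [1] and divide by
[nodal A]. *)
Lemma sum_weight_inv A x : (0 < #|A|)%N -> x \notin A ->
  \sum_(a in A) weight A a / (x - a) = (nodal A).[x]^-1.
Proof.
move=> A0 xA; have nz := nodal_neq0 xA.
have s1 : (size (1%:P : {poly K}) <= #|A|)%N by rewrite size_polyC oner_eq0.
apply: (mulIf nz); rewrite mulVf // mulr_suml.
rewrite -[RHS](hornerC 1 x) [in RHS](lagrange_interpolation s1) horner_sum.
apply: eq_bigr => a aA; rewrite hornerZ hornerC mulr1 (nodalD1 aA).
rewrite hornerM hornerXsubC mulrA mulfVK // subr_eq0.
by apply: contraNneq xA => ->.
Qed.

(** Derivative of the interpolation of [1]: with [n = nodal A] and [n_a] the
cofactor of the root [a], [n_a'(x)] is [n'(x) / (x - a) - n(x) / (x - a)^2]. *)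
Lemma sum_weight_inv2 A x : (0 < #|A|)%N -> x \notin A ->
  \sum_(a in A) weight A a / (x - a) ^+ 2
    = (nodal A)^`().[x] / (nodal A).[x] ^+ 2.
Proof.
move=> A0 xA; have nz := nodal_neq0 xA.
have s1 : (size (1%:P : {poly K}) <= #|A|)%N by rewrite size_polyC oner_eq0.
have := congr1 (fun f => f^`().[x]) (lagrange_interpolation s1).
rewrite derivC horner0 raddf_sum horner_sum => e.
apply: (mulIf nz); rewrite [in RHS]expr2 invfM mulrA mulfVK //.
rewrite -(sum_weight_inv A0 xA) mulr_sumr mulr_suml.
apply/eqP; rewrite -subr_eq0 -opprB oppr_eq0 -sumrB; apply/eqP.
rewrite [RHS]e; apply: eq_bigr => a aA.
have xa : x - a != 0 by rewrite subr_eq0; apply: contraNneq xA => ->.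
rewrite (nodalD1 aA) /= derivZ hornerZ hornerC derivM derivXsubC mul1r.
rewrite hornerD !hornerM hornerXsubC.
by field.
Qed.

End Nodal.

Lemma coef_XaddC_exp (R : comNzRingType) (c : R) m j :
  (('X + c%:P) ^+ m)`_j = c ^+ (m - j) *+ 'C(m, j).
Proof.
rewrite addrC exprDn.
rewrite (eq_bigr (fun i : 'I_m.+1 => (c ^+ (m - i) *+ 'C(m, i)) *: 'X^i)).
  rewrite -(poly_def m.+1 (fun i => c ^+ (m - i) *+ 'C(m, i))) coef_poly ltnS.
  by case: leqP => // mj; rewrite bin_small.
by move=> i _; rewrite -polyC_exp mul_polyC scalerMnl.
Qed.

(** * The auxiliary polynomial and its zeros *)

Section Stepanov.
Variable K : finFieldType.
Implicit Types (A B : {set K}) (f : {poly K}) (c e k x : K).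

(** Stepanov's auxiliary polynomial: the weights cancel the high-degree terms,
and [k] is chosen later, to make the polynomial vanish at given points. *)
Definition stepanov A m (k : K) : {poly K} :=
  \sum_(a in A) weight A a *: ('X - a%:P) ^+ m - k%:P.

(** Coefficients after the translation by [x] are Taylor coefficients at [x];
working with them avoids dividing by factorials in positive characteristic. *)
Lemma coef_stepanov_shift A m k x j :
  (stepanov A m k \Po ('X + x%:P))`_j
    = (\sum_(a in A) weight A a * (x - a) ^+ (m - j)) *+ 'C(m, j)
      - k *+ (j == 0%N).
Proof.
rewrite /stepanov comp_polyB raddf_sum /= comp_polyC coefB coefC coef_sum.
rewrite -sumrMnl mulrb; congr (_ - _); apply: eq_bigr => a _.
rewrite comp_polyZ coefZ rmorphXn /= comp_polyB comp_polyX comp_polyC.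
by rewrite -addrA -polyCB coef_XaddC_exp mulrnAr.
Qed.

Lemma size_stepanov A d k : (0 < #|A|)%N ->
  (size (stepanov A (d + #|A|.-1) k) <= d.+1)%N.
Proof.
move=> A0; apply/leq_sizeP => j dj.
have := coef_stepanov_shift A (d + #|A|.-1) k 0 j.
rewrite polyC0 addr0 comp_polyXr => ->.
have -> : (j == 0%N) = false by lia.
rewrite mulr0n subr0.
have [lt|ge] := ltnP (d + #|A|.-1) j; first by rewrite bin_small.
have jA : (d + #|A|.-1 - j < #|A|)%N by lia.
rewrite sum_weight_exp //.
have -> : (d + #|A|.-1 - j == #|A|.-1)%N = false by lia.
by rewrite mulr0n mul0rn.
Qed.

(** Since [(x - a) ^+ d] does not depend on [a], it can be taken out of the
sum; what remains is a moment of the weights of order below [#|A|], which is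
nonzero only when [j = 0], where it is balanced by the constant term. *)
Lemma coef_stepanov_shift_small A d e x j : (0 < #|A|)%N ->
  {in A, forall a, (x - a) ^+ d = e} -> (j < #|A|)%N ->
  (stepanov A (d + #|A|.-1) (e * (-1) ^+ #|A|.-1) \Po ('X + x%:P))`_j = 0.
Proof.
move=> A0 xe jA; rewrite coef_stepanov_shift.
have -> : (d + #|A|.-1 - j = d + (#|A|.-1 - j))%N by lia.
rewrite (eq_bigr (fun a => e * (weight A a * (x - a) ^+ (#|A|.-1 - j))));
  last by move=> a aA; rewrite exprD xe // mulrCA.
have jA' : (#|A|.-1 - j < #|A|)%N by lia.
rewrite -mulr_sumr sum_weight_exp //.
case: j jA {jA'} => [|j] jA; first by rewrite subn0 eqxx bin0 subrr.
have -> : (#|A|.-1 - j.+1 == #|A|.-1)%N = false by lia.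
by rewrite !mulr0n mulr0 mul0rn subr0.
Qed.

Lemma dvdp_Xn f n : (forall j, (j < n)%N -> f`_j = 0) -> 'X^n %| f.
Proof.
move=> f0; apply/dvdpP; exists (drop_poly n f).
rewrite -[LHS](poly_take_drop n); suff -> : take_poly n f = 0 by rewrite add0r.
by apply/polyP=> j; rewrite coef_take_poly coef0; case: ltnP => // /f0.
Qed.

Lemma dvdp_XsubC_exp_shift f x n :
  'X^n %| f \Po ('X + x%:P) -> ('X - x%:P) ^+ n %| f.
Proof.
case/dvdpP=> q e; apply/dvdpP; exists (q \Po ('X - x%:P)).
have := congr1 (fun f => f \Po ('X - x%:P)) e.
rewrite -comp_polyA comp_polyD comp_polyX comp_polyC subrK comp_polyXr => ->.
by rewrite comp_polyM rmorphXn /= comp_polyX.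
Qed.

Lemma nodal_exp_dvdp B n f : {in B, forall b, ('X - b%:P) ^+ n %| f} ->
  nodal B ^+ n %| f.
Proof.
rewrite /nodal -big_enum /= => Bf.
have: {in enum B, forall b, ('X - b%:P) ^+ n %| f}.
  by move=> b; rewrite mem_enum; apply: Bf.
elim: (enum B) (enum_uniq B) => [|b s IHs] /=.
  by rewrite big_nil expr1n dvd1p.
case/andP=> bs us sf; rewrite big_cons exprMn Gauss_dvdp.
  by rewrite sf ?mem_head // IHs // => c cs; rewrite sf // in_cons cs orbT.
rewrite coprimep_expl // coprimep_expr // coprimep_sym.
by rewrite coprimep_XsubC root_prod_XsubC.
Qed.

(** The vanishing order at the points of [B] forces the divisor [nodal B ^+ #|A|],
of degree [#|A| * #|B| >= d], while the degree of the polynomial is at most [d]. *)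
Lemma stepanov_eq A B d e : (0 < #|A|)%N -> (d <= #|A| * #|B|)%N ->
  {in A & B, forall a b, (b - a) ^+ d = e} ->
  exists c, stepanov A (d + #|A|.-1) (e * (-1) ^+ #|A|.-1)
            = c *: nodal B ^+ #|A|.
Proof.
move=> A0 dAB ABe; set P := stepanov _ _ _.
have /dvdpP[q Pq] : nodal B ^+ #|A| %| P.
  apply: nodal_exp_dvdp => b bB; apply: dvdp_XsubC_exp_shift.
  apply: dvdp_Xn => j jA; apply: coef_stepanov_shift_small => // a aA.
  exact: ABe.
suff /size1_polyC q1 : (size q <= 1)%N.
  by exists q`_0; rewrite Pq q1 mul_polyC coefC eqxx.
have [->|q0] := eqVneq q 0; first by rewrite size_poly0.
have Bmon : nodal B ^+ #|A| \is monic by rewrite rpredX // nodal_monic.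
have := size_stepanov d (e * (-1) ^+ #|A|.-1) A0.
have := size_exp (nodal B) #|A|; rewrite size_nodal /= mulnC => sB.
have := monic_neq0 Bmon; rewrite -size_poly_gt0 => sB0.
rewrite -/P Pq size_Mmonic // => le.
by move: (size q) (size (nodal B ^+ #|A|)) (#|A| * #|B|)%N sB sB0 le dAB; lia.
Qed.

(** * Logarithmic derivatives at the zeros *)

Lemma coefs_local_power f n :
  (('X * f) ^+ n.+1)`_n.+1 = f`_0 ^+ n.+1
  /\ (('X * f) ^+ n.+1)`_n.+2 = f`_1 * f`_0 ^+ n *+ n.+1.
Proof.
rewrite exprMn ![('X^_ * _)`_ _]coefXnM ltnn ltnNge leqnSn subnn subSn // subnn /=.
rewrite -!horner_coef0 horner_exp; split=> //.
have /= := coef_deriv (f ^+ n.+1) 0; rewrite mulr1n => <-.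
rewrite -horner_coef0 deriv_exp hornerMn hornerM horner_exp /= mulrC.
by rewrite [f^`().[0]]horner_coef0 coef_deriv mulr1n mulrC.
Qed.

(** Compare the coefficients of orders [#|A|] and [#|A| + 1] at [b] in the
identity [stepanov_eq]: their ratio is a logarithmic derivative of [nodal A]
on one side, and of the cofactor of [b] in [nodal B] on the other. *)
Lemma stepanov_log_derivative A B d e b :
    (0 < #|A|)%N -> (1 < d)%N -> (d <= #|A| * #|B|)%N ->
    'C(d + #|A|.-1, #|A|)%:R != 0 :> K -> e != 0 ->
    {in A & B, forall a b, (b - a) ^+ d = e} -> b \in B ->
  2 * (d%:R - 1) * ((nodal A)^`().[b] / (nodal A).[b])
  = #|A|%:R * (#|A|%:R + 1) * ((nodal B)^`(2).[b] / (nodal B)^`().[b]).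
Proof.
move=> A0 d1 dAB C0 e0 ABe bB.
have bA : b \notin A.
  apply: contraNN e0 => bA; rewrite -(ABe _ _ bA bB) subrr expr0n.
  by case: d d1 {dAB C0 ABe}.
have [c Pc] := stepanov_eq A0 dAB ABe.
set n := #|A|.-1 in Pc *; have An : #|A| = n.+1 by rewrite prednK.
set F1 := nodal (B :\ b); set f := F1 \Po ('X + b%:P).
(* [F1] and [f] are the cofactor of the root [b], before and after moving [b] to
   the origin; [f`_0] and [2 * f`_1] are the first two derivatives of [nodal B]
   at [b]. *)
have F1b : F1.[b] != 0 by apply: nodal_neq0; rewrite !inE eqxx.
have f0 : f`_0 = F1.[b].
  by rewrite -horner_coef0 horner_comp !hornerE.
have f1 : f`_1 = F1^`().[b].
  have /= := coef_deriv f 0; rewrite mulr1n => <-.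
  rewrite -horner_coef0 deriv_comp derivD derivX derivC addr0 mulr1 horner_comp.
  by rewrite !hornerE.
have shift : (c *: nodal B ^+ #|A|) \Po ('X + b%:P) = c *: ('X * f) ^+ n.+1.
  rewrite comp_polyZ rmorphXn /= An (nodalD1 bB) comp_polyM comp_polyB.
  by rewrite comp_polyX comp_polyC addrK.
have [co1 co2] := coefs_local_power f n.
have S1 : (stepanov A (d + n) (e * (-1) ^+ n) \Po ('X + b%:P))`_n.+1
  = e * (nodal A).[b]^-1 * 'C(d + n, n.+1)%:R.
  rewrite [RHS]mulr_natr coef_stepanov_shift subr0 -(sum_weight_inv A0 bA).
  rewrite mulr_sumr.
  congr (_ *+ _); apply: eq_bigr => a aA; rewrite -(ABe _ _ aA bB).
  have ba : b - a != 0 by rewrite subr_eq0; apply: contraNneq bA => ->.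
  have -> : (d + n - n.+1 = d.-1)%N by lia.
  by case: d d1 {dAB C0 ABe Pc} => // d _; rewrite exprS /=; field.
have S2 : (stepanov A (d + n) (e * (-1) ^+ n) \Po ('X + b%:P))`_n.+2
  = e * ((nodal A)^`().[b] / (nodal A).[b] ^+ 2) * 'C(d + n, n.+2)%:R.
  rewrite [RHS]mulr_natr coef_stepanov_shift subr0 -(sum_weight_inv2 A0 bA).
  rewrite mulr_sumr.
  congr (_ *+ _); apply: eq_bigr => a aA; rewrite -(ABe _ _ aA bB).
  have ba : b - a != 0 by rewrite subr_eq0; apply: contraNneq bA => ->.
  have -> : (d + n - n.+2 = d.-2)%N by lia.
  by case: d d1 {dAB C0 ABe Pc S1} => // [[|d]] // _; rewrite !exprS /=; field.
rewrite Pc shift coefZ co1 f0 in S1.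
rewrite Pc shift coefZ co2 f0 f1 in S2.
have F'b : (nodal B)^`().[b] = F1.[b].
  by rewrite (nodalD1 bB) derivM derivXsubC !hornerE subrr mul0r addr0.
have F''b : (nodal B)^`(2).[b] = 2 * F1^`().[b].
  rewrite derivnS derivn1 (nodalD1 bB) derivM derivXsubC mul1r.
  rewrite derivD derivM derivXsubC mul1r.
  rewrite !(hornerD, hornerM, hornerN, hornerX, hornerC) subrr.
  by ring.
have bin : (n.+1%:R + 1) * 'C(d + n, n.+2)%:R
           = (d%:R - 1) * 'C(d + n, n.+1)%:R :> K.
  have -> : d%:R - 1 = d.-1%:R :> K.
    by apply/eqP; rewrite subr_eq natr1 prednK // ltnW.
  rewrite natr1 -[LHS]natrM -[RHS]natrM mul_bin_left.
  by have -> : (d + n - n.+1 = d.-1)%N by lia.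
rewrite -[in LHS]mulr_natr in S2.
rewrite An in C0.
rewrite F'b F''b An.
have G0 := nodal_neq0 bA.
(* The ratio of the two comparisons [S1] and [S2], multiplied by [#|A| + 1]
   to relate the binomial coefficients. *)
have key : (n.+1%:R + 1) * (n.+1%:R * F1^`().[b])
         = (d%:R - 1) * ((nodal A)^`().[b] / (nodal A).[b] * F1.[b]).
  apply: (@mulfI _ (e * (nodal A).[b]^-1 * 'C(d + n, n.+1)%:R)).
    by rewrite !mulf_neq0 ?invr_eq0.
  transitivity ((n.+1%:R + 1) * F1.[b]
                * (e * ((nodal A)^`().[b] / (nodal A).[b] ^+ 2)
                   * 'C(d + n, n.+2)%:R)).
    by rewrite -S1 -S2 exprS; ring.
  transitivity (F1.[b] * e * ((nodal A)^`().[b] / (nodal A).[b] ^+ 2)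
                * ((n.+1%:R + 1) * 'C(d + n, n.+2)%:R)); first by ring.
  by rewrite bin; field.
apply: (mulIf F1b); transitivity (2 * ((n.+1%:R + 1) * (n.+1%:R * F1^`().[b]))).
  by rewrite key; ring.
by field.
Qed.

End Stepanov.

(** * From relations at the roots to a polynomial identity *)

(** On [B] the term containing [nodal B] vanishes and the relation there is the
identity with denominators cleared; likewise on [C].  Two polynomials of degree
less than [#|B| + #|C|] that agree on [B :|: C] are equal. *)
Lemma poly_identity_of_roots (K : finFieldType) (B C : {set K}) (x y z : K) :
    [disjoint B & C] ->
    {in B, forall b, z * ((nodal C)^`().[b] / (nodal C).[b])
                     = x * ((nodal B)^`(2).[b] / (nodal B)^`().[b])} ->
    {in C, forall c, z * ((nodal B)^`().[c] / (nodal B).[c])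
                     = y * ((nodal C)^`(2).[c] / (nodal C)^`().[c])} ->
  x *: (nodal C * (nodal B)^`(2)) + y *: (nodal B * (nodal C)^`(2))
  = z *: ((nodal B)^`() * (nodal C)^`()).
Proof.
have simple (A : {set K}) a : a \in A -> (nodal A)^`().[a] != 0 :> K.
  move=> aA; rewrite (nodalD1 aA) derivM derivXsubC mul1r hornerD hornerM.
  rewrite hornerXsubC subrr mul0r addr0 nodal_neq0 //.
  by rewrite !inE eqxx.
have szD (A : {set K}) k : (size (nodal A)^`(k) <= #|A|.+1 - k)%N.
  rewrite -size_nodal; elim: k => [|k IHk]; first by rewrite subn0.
  rewrite derivnS; have [->|nz] := eqVneq (nodal A)^`(k) 0.
    by rewrite raddf0 size_poly0.
  by have := lt_size_deriv nz; lia.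
move=> disj HB HC.
have szM (f g : {poly K}) : (size f + size g <= (#|B| + #|C|).+1)%N ->
    (size (f * g)%R <= #|B| + #|C|)%N.
  by move=> h; apply: leq_trans (size_polyMleq _ _) _; move: h; lia.
have szG : size (nodal C) = #|C|.+1 by apply: size_nodal.
have szF : size (nodal B) = #|B|.+1 by apply: size_nodal.
have cardBC : #|B :|: C| = (#|B| + #|C|)%N.
  by rewrite cardsU disjoint_setI0 ?cards0 ?subn0.
apply: (@poly_eq_on _ (B :|: C)); rewrite ?cardBC.
- move=> u; rewrite inE !(hornerD, hornerZ, hornerM).
  case/orP=> [uB|uC].
    have F0 : (nodal B).[u] = 0 by apply/rootP; rewrite root_nodal.
    have G0 := nodal_neq0 (negbT (disjointFr disj uB)).
    have F'0 := simple B u uB.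
    rewrite F0 mul0r mulr0 addr0.
    transitivity (x * ((nodal B)^`(2).[u] / (nodal B)^`().[u])
                  * ((nodal C).[u] * (nodal B)^`().[u])); first by field.
    by rewrite -HB //; field.
  have G0 : (nodal C).[u] = 0 by apply/rootP; rewrite root_nodal.
  have F0 := nodal_neq0 (negbT (disjointFl disj uC)).
  have G'0 := simple C u uC.
  rewrite G0 mul0r mulr0 add0r.
  transitivity (y * ((nodal C)^`(2).[u] / (nodal C)^`().[u])
                * ((nodal B).[u] * (nodal C)^`().[u])); first by field.
  by rewrite -HC //; field.
- rewrite (leq_trans (size_polyD _ _)) // geq_max.
  rewrite !(leq_trans (size_scale_leq _ _)) //; apply: szM.
    rewrite szF; have := szD C 2; move: (size _) #|B| #|C| => ? ? ?; lia.
  rewrite szG; have := szD B 2; move: (size _) #|B| #|C| => ? ? ?; lia.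
- rewrite (leq_trans (size_scale_leq _ _)) //; apply: szM.
  have := szD C 1%N; have := szD B 1%N.
  by move: (size _) (size _) #|B| #|C| => ? ? ? ?; lia.
Qed.

(** * Sumsets and subgroups of the unit group *)

(** The binomial coefficient divides [n`!], all of whose factors are below [p]. *)
Lemma prime_ndvd_bin p n k : prime p -> (n < p)%N -> (k <= n)%N ->
  ~~ (p %| 'C(n, k))%N.
Proof.
move=> hp np kn; have fact_ndvd : ~~ (p %| n`!)%N.
  elim: n np {kn} => [|n IHn] np; first by rewrite dvdn1 neq_ltn prime_gt1 ?orbT.
  by rewrite factS Euclid_dvdM // negb_or IHn ?andbT ?gtnNdvd // ltnW.
by apply: contra fact_ndvd => /dvdn_mulr; rewrite -(bin_fact kn); apply.
Qed.

(** By Lagrange the index is at least [2]. *)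
Lemma card_proper_unit_subgroup (K : finFieldType) (H : {group {unit K}}) :
  H \proper [set: {unit K}] -> (2 * #|H| <= #|K|.-1)%N.
Proof.
move=> hH; rewrite -card_finField_unit.
have /dvdnP[k kH] := cardSg (proper_sub hH).
have := proper_card hH; rewrite kH /=.
by case: k {kH} => [|[|k]]; rewrite ?mul0n ?mul1n ?ltnn // leq_mul2r orbT.
Qed.

Section Sumset.
Variable V : finZmodType.
Implicit Types A B : {set V}.

Lemma card_sumset_le A B : (#|sumset A B| <= #|A| * #|B|)%N.
Proof.
by rewrite /sumset curry_imset2X (leq_trans (leq_imset_card _ _)) // cardsX.
Qed.

Lemma card_le_sumsetl A B : (0 < #|B|)%N -> (#|A| <= #|sumset A B|)%N.
Proof.
case/card_gt0P=> b bB; rewrite -(card_imset (mem A) (addIr b)) subset_leq_card //.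
by apply/subsetP => _ /imsetP[a aA ->]; apply: imset2_f.
Qed.

Lemma sumsetC A B : sumset A B = sumset B A.
Proof.
apply/setP=> x; apply/imset2P/imset2P => -[a b aA bB ->];
  by exists b a; rewrite // addrC.
Qed.

End Sumset.

Lemma unit_image_expr_card (R : finUnitRingType) (H : {group {unit R}}) x :
  x \in unit_image H -> x ^+ #|H| = 1.
Proof. by case/imsetP=> u uH ->; rewrite -FinRing.val_unitX expg_cardG. Qed.

Lemma card_unit_image (R : finUnitRingType) (H : {set {unit R}}) :
  #|unit_image H| = #|H|.
Proof. exact/card_imset/val_inj. Qed.

(** * The theorem *)

Theorem proposition2p8 (p : nat) (hp : prime p)
    (H : {group {unit 'F_p}}) (hH : H \proper [set: {unit 'F_p}])
    (A B : {set 'F_p})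
    (hHAB : unit_image H = sumset A B)
    (hA : (2 <= #|A|)%N) (hB : (2 <= #|B|)%N)
    (hA0 : \sum_(a in A) a = 0) (hB0 : \sum_(b in B) b = 0) :
  let d : 'F_p := #|H|%:R in
  let alpha : 'F_p := #|A|%:R in
  let beta : 'F_p := #|B|%:R in
  let F : {poly 'F_p} := \prod_(b in B) ('X - b%:P) in
  let G : {poly 'F_p} := \prod_(a in A) ('X + a%:P) in
  [/\ forall b : 'F_p, root F b ->
        2 * (d - 1) * (G^`().[b] / G.[b])
        = alpha * (alpha + 1) * (F^`(2).[b] / F^`().[b]),
      forall z : 'F_p, root G z ->
        2 * (d - 1) * (F^`().[z] / F.[z])
        = beta * (beta + 1) * (G^`(2).[z] / G^`().[z])
    & (alpha * (alpha + 1)) *: (G * F^`(2)) + (beta * (beta + 1)) *: (F * G^`(2))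
      = (2 * (d - 1)) *: (F^`() * G^`())].
Proof.
move=> d alpha beta F G.
pose C : {set 'F_p} := [set - a | a in A].
have cardC : #|C| = #|A| by apply/card_imset/oppr_inj.
have GE : G = nodal C.
  rewrite /nodal big_imset /=; last by move=> u v _ _; apply: oppr_inj.
  by apply: eq_bigr => a _; rewrite polyCN opprK.
have cardH : #|H| = #|sumset A B| by rewrite -hHAB card_unit_image.
have HAB : (#|H| <= #|A| * #|B|)%N by rewrite cardH card_sumset_le.
have AH : (#|A| <= #|H|)%N by rewrite cardH card_le_sumsetl // ltnW.
have BH : (#|B| <= #|H|)%N by rewrite cardH sumsetC card_le_sumsetl // ltnW.
have Hp : (2 * #|H| <= p.-1)%N.
  by have := card_proper_unit_subgroup hH; rewrite card_Fp.
have H1 : (1 < #|H|)%N by apply: leq_trans hA AH.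
have p1 := prime_gt1 hp.
have sum1 a b : a \in A -> b \in B -> (a + b) ^+ #|H| = 1.
  move=> aA bB; apply: unit_image_expr_card.
  by rewrite hHAB; apply: imset2_f.
have bin k : (1 < k)%N -> (k <= #|H|)%N ->
    'C(#|H| + k.-1, k)%:R != 0 :> 'F_p.
  move=> k1 kH; rewrite -(dvdn_pcharf (pchar_Fp hp)).
  by apply: prime_ndvd_bin => //; move: #|H| kH Hp p1 => h; lia.
have atF : {in B, forall b, 2 * (d - 1) * ((nodal C)^`().[b] / (nodal C).[b])
    = alpha * (alpha + 1) * ((nodal B)^`(2).[b] / (nodal B)^`().[b])}.
  move=> b bB; rewrite /alpha -cardC.
  apply: (@stepanov_log_derivative _ _ _ _ 1); rewrite ?cardC ?oner_eq0 //.
  - by rewrite ltnW.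
  - exact: bin.
  - by move=> _ b' /imsetP[a aA ->] b'B; rewrite opprK addrC sum1.
have atG : {in C, forall z, 2 * (d - 1) * ((nodal B)^`().[z] / (nodal B).[z])
    = beta * (beta + 1) * ((nodal C)^`(2).[z] / (nodal C)^`().[z])}.
  move=> z zC.
  apply: (@stepanov_log_derivative _ _ _ _ ((-1) ^+ #|H|)); rewrite ?cardC //.
  - by rewrite ltnW.
  - by rewrite mulnC.
  - exact: bin.
  - by rewrite expf_neq0 // oppr_eq0 oner_eq0.
  - move=> b _ bB /imsetP[a aA ->].
    by rewrite -opprD [LHS]exprNn sum1 ?mulr1.
rewrite GE; split.
- by move=> b; rewrite root_nodal; apply: atF.
- by move=> z; rewrite root_nodal; apply: atG.
apply: poly_identity_of_roots => //.
rewrite disjoint_sym -setI_eq0; apply/eqP/setP=> b; rewrite !inE.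
(* A common element would give [0 = a - a] in [H]. *)
apply/andP=> -[/imsetP[a aA ->] aB].
have := sum1 a _ aA aB; rewrite subrr expr0n; by case: #|H| H1.
Qed.
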